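(* Let $\mathcal{T}=(V,E)$ be a countably infinite rooted and leafless directed tree, $\boldsymbol{\beta}=\{\beta_v\}_{v\in V}\subseteq(0,\infty)$ and $\boldsymbol{\lambda}=\{\lambda_v\}_{v\in V^\circ}\subseteq(0,\infty)$. Let the weighted shift $S_{\boldsymbol{\lambda}}$ on $\mathcal{T}_{\boldsymbol{\beta}}$ be bounded on $\ell^2(\boldsymbol{\beta})$. Let $\hat\varphi:\mathbb{N}_0\to\mathbb{C}$ be such that the series $\sum_{k=0}^\infty\hat\varphi(k)z^k$ is convergent for every $z\in\varDelta_{\|S_{\boldsymbol\lambda}\|}$. If the function $\varphi:\varDelta_{\|S_{\boldsymbol\lambda}\|}\to\mathbb{C}$ given by $\varphi(z)=\sum_{k=0}^\infty\hat\varphi(k)z^k$ is bounded, then $\hat\varphi\in\mathcal{M}(\mathcal{T}_{\boldsymbol{\beta}},\boldsymbol{\lambda})$ and $\|M_{\hat\varphi}\|\le\|\varphi\|_\infty:=\sup\{|\varphi(z)|:|z|<\|S_{\boldsymbol\lambda}\|\}$.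
   Context: $\mathbb{N}_0=\{0,1,2,\dots\}$; $\varDelta_r=\{z\in\mathbb{C}:|z|<r\}$ for $r>0$. A rooted directed tree $\mathcal{T}=(V,E)$ is a connected directed graph without circuits having a unique vertex $\mathrm{root}$ without a parent and such that every $v\in V^\circ:=V\setminus\{\mathrm{root}\}$ has a unique parent $\mathrm{par}(v)$, i.e. a unique $u$ with $(u,v)\in E$. $\mathrm{par}^k$ is the $k$-fold composition of $\mathrm{par}$ ($\mathrm{par}^0$ the identity); $\mathrm{Chi}(u)=\{v\in V:(u,v)\in E\}$; leafless means every vertex has at least one child; $|v|$ is the unique $k\in\mathbb{N}_0$ with $\mathrm{par}^k(v)=\mathrm{root}$. For $v$ a descendant of $u$, i.e. $\mathrm{par}^n(v)=u$ for some $n\in\mathbb{N}_0$, put $\lambda_{u|v}=\prod_{j=0}^{n-1}\lambda_{\mathrm{par}^j(v)}$ (equal to $1$ if $u=v$). $\ell^2(\boldsymbol{\beta})$ is the Hilbert space of all $f:V\to\mathbb{C}$ with $\|f\|_{\boldsymbol\beta}^2=\sum_{v\in V}|f(v)|^2\beta_v<\infty$, with $\langle f,g\rangle_{\boldsymbol\beta}=\sum_{v\in V} f(v)\overline{g(v)}\beta_v$. $\mathcal{T}_{\boldsymbol\beta}$ denotes the pair $(\mathcal{T},\boldsymbol\beta)$. The weighted shift $S_{\boldsymbol{\lambda}}$ on $\mathcal{T}_{\boldsymbol\beta}$ is given by $(S_{\boldsymbol\lambda}f)(v)=\lambda_v f(\mathrm{par}(v))$ for $v\in V^\circ$, $(S_{\boldsymbol\lambda}f)(\mathrm{root})=0$,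 on the domain of all $f\in\ell^2(\boldsymbol\beta)$ for which the resulting function lies in $\ell^2(\boldsymbol\beta)$. For $\hat\varphi:\mathbb{N}_0\to\mathbb{C}$ let $(\Gamma_{\hat\varphi}f)(v)=\sum_{k=0}^{|v|}\lambda_{\mathrm{par}^k(v)|v}\,\hat\varphi(k)\,f(\mathrm{par}^k(v))$ for $f\in\mathbb{C}^V$, $v\in V$. The multiplication operator $M_{\hat\varphi}$ in $\ell^2(\boldsymbol\beta)$ has domain $\{f\in\ell^2(\boldsymbol\beta):\Gamma_{\hat\varphi}f\in\ell^2(\boldsymbol\beta)\}$ and acts by $M_{\hat\varphi}f=\Gamma_{\hat\varphi}f$. $\mathcal{M}(\mathcal{T}_{\boldsymbol\beta},\boldsymbol\lambda)$ is the set of all $\hat\varphi:\mathbb{N}_0\to\mathbb{C}$ for which the domain of $M_{\hat\varphi}$ is all of $\ell^2(\boldsymbol\beta)$ (then $M_{\hat\varphi}$ is bounded). *)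

(* Defs.v *)
From HB Require Import structures.
From mathcomp Require Import all_boot all_order all_algebra.
From mathcomp Require Import complex.
From mathcomp Require Import all_classical all_reals all_analysis.

Set Implicit Arguments.
Unset Strict Implicit.
Unset Printing Implicit Defensive.

Import Order.TTheory GRing.Theory Num.Theory.
Import numFieldNormedType.Exports.

Local Open Scope classical_set_scope.
Local Open Scope ring_scope.
Local Open Scope complex_scope.

(* MathComp-Analysis world.  Complex numbers are [R[i]] for [R : realType], and
   [Normc.normc z : R] is the modulus as an element of [R].  Topological notions
   go through [R[i]^o], where the library puts the topology of the norm. *)

Section Tree.
Variable V : choiceType.

(* A loop [u -> u] is the cycle [:: u], so it is excluded as well. *)
Definition without_circuits (E : rel V) : Prop :=
  forall c : seq V, uniq c -> cycle E c -> c = [::].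

Definition connected_digraph (E : rel V) : Prop :=
  forall u v, exists2 p : seq V,
    path [rel x y | E x y || E y x] u p & last u p = v.

Record rooted_directed_tree := RootedDirectedTree {
  edge : rel V;
  troot : V;
  tree_connected : connected_digraph edge;
  tree_acyclic : without_circuits edge;
  root_parentless : forall u, ~~ edge u troot;
  root_unique : forall v, (forall u, ~~ edge u v) -> v = troot;
  parent_unique : forall v, v != troot -> exists! u, edge u v }.

Variable T : rooted_directed_tree.

Definition children (u : V) : set V := [set v | edge T u v].

Definition leafless : Prop := forall u, children u !=set0.

(* Total by convention: [par troot = troot]. *)
Definition par (v : V) : V := xget (troot T) [set u | edge T u v].

(* [gen u v] is the unique [n] with [par^n(v) = u], if there is one.  The
   second clause says that [par^n] is defined at [v] as a composition of
   partial maps, i.e. that the convention [par troot = troot] is not used. *)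
Definition gen (u v : V) : nat :=
  xget 0%N [set n | iter n par v = u /\
                    forall j, (j < n)%N -> iter j par v != troot T].

Definition depth (v : V) : nat := gen (troot T) v.

End Tree.

Section L2.
Variables (R : realType) (V : choiceType) (beta : V -> R).

Definition l2sum (f : V -> R[i]) : \bar R :=
  (\esum_(v in [set: V]) (Normc.normc (f v) ^+ 2 * beta v)%:E)%E.

Definition l2 : set (V -> R[i]) := [set f | (l2sum f < +oo)%E].

Definition l2norm (f : V -> R[i]) : R := Num.sqrt (fine (l2sum f)).

(* Only the values of [act] on [dom] are meaningful. *)
Record operator := Operator {
  dom : set (V -> R[i]);
  act : (V -> R[i]) -> (V -> R[i]) }.

Definition maximal_operator (L : (V -> R[i]) -> (V -> R[i])) : operator :=
  {| dom := [set f | l2 f /\ l2 (L f)]; act := L |}.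

(* Extended-real valued, so that an unbounded operator has norm [+oo]. *)
Definition opnorm (A : operator) : \bar R :=
  ereal_sup [set (l2norm (act A f))%:E | f in [set f | dom A f /\ l2norm f <= 1]].

Definition bounded_on_l2 (A : operator) : Prop :=
  dom A = l2 /\ (opnorm A < +oo)%E.

End L2.

Section Shift.
Variables (R : realType) (V : choiceType) (T : rooted_directed_tree V).
(* [lambda (troot T)] is never used. *)
Variables (beta lambda : V -> R).

Definition wshift : operator R V :=
  maximal_operator beta (fun f v =>
    if v == troot T then 0 else (lambda v)%:C * f (par T v)).

Definition lambda_path (u v : V) : R :=
  \prod_(0 <= j < gen T u v) lambda (iter j (par T) v).

Definition Gamma (phihat : nat -> R[i]) (f : V -> R[i]) (v : V) : R[i] :=
  \sum_(0 <= k < (depth T v).+1)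
    (lambda_path (iter k (par T) v) v)%:C * phihat k * f (iter k (par T) v).

Definition mult_op (phihat : nat -> R[i]) : operator R V :=
  maximal_operator beta (Gamma phihat).

Definition multipliers : set (nat -> R[i]) :=
  [set phihat | dom (mult_op phihat) = l2 beta].

End Shift.

Section PowerSeries.
Variable R : realType.

Definition disc (r : \bar R) : set R[i] :=
  [set z | ((Normc.normc z)%:E < r)%E].

Definition power_series (phihat : nat -> R[i]) (z : R[i]) : nat -> R[i]^o :=
  series (fun k => phihat k * z ^+ k).

Definition power_sum (phihat : nat -> R[i]) (z : R[i]) : R[i] :=
  limn (power_series phihat z).

Definition sup_norm (D : set R[i]) (phi : R[i] -> R[i]) : \bar R :=
  ereal_sup [set (Normc.normc (phi z))%:E | z in D].

End PowerSeries.

(* Main.v *)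
(* Along the path from the root to a vertex, [f / lambda_(root|.)] becomes a
   finite sequence on which [Gamma] acts as convolution with [phihat].  Discrete
   Parseval on circles [|z| = rho < s := ||S||], applied to truncations of
   [phi], shows that this convolution multiplies the norm with weights [s^(2i)] by at
   most [sup |phi|].  Boundedness of [S] says exactly that
   [mu v := lambda_(root|v)^2 beta_v / s^(2|v|)] is superharmonic: the sum of
   [mu] over the children of [u] is at most [mu u].  Hence [mu] restricted to a
   finite depth is a positive combination of root-to-vertex paths, and the
   inequality on paths integrates to the inequality on the tree. *)
Require Import Defs.
From mathcomp Require Import all_boot all_order all_algebra.
From mathcomp Require Import complex.
From mathcomp Require Import all_classical all_reals all_analysis.
From mathcomp Require Import cyclic separable cyclotomic zify ring.

Set Implicit Arguments.
Unset Strict Implicit.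
Unset Printing Implicit Defensive.

Import Order.TTheory GRing.Theory Num.Theory.
Import numFieldNormedType.Exports.

Local Open Scope classical_set_scope.
Local Open Scope ring_scope.

(** * Roots of unity, discrete Parseval, and polynomial multiplication on a circle *)

(** In characteristic zero ['X^n - 1] is separable and splits, so it has [n] distinct roots, and [n]
    distinct [n]-th roots of unity include a primitive one. *)
Lemma closed_prim_root_exists (C : numClosedFieldType) (n : nat) :
  (0 < n)%N -> exists z : C, n.-primitive_root z.
Proof.
move=> n_gt0; pose p : {poly C} := 'X^n - 1.
have [r Dp] := closed_field_poly_normal p.
move: Dp; rewrite (monicP _) ?monicXnsubC // scale1r => Dp.
have rn1 : all n.-unity_root r.
  by apply/allP => z; rewrite -root_prod_XsubC -Dp.
have size_r : size r = n.
  by apply: succn_inj; rewrite -(size_prod_XsubC r idfun) /= -Dp size_XnsubC.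
have uniq_r : uniq r.
  rewrite -separable_prod_XsubC -Dp separable_Xn_sub_1 // pnatr_eq0; lia.
by have /hasP[z _ prim_z] := has_prim_root n_gt0 rn1 uniq_r (eq_leq (esym size_r));
  exists z.
Qed.

(** Orthogonality of characters: for [i != k] this is a geometric sum whose ratio [w != 1] satisfies
    [w ^+ n = 1]. *)
Lemma sum_prim_root_exp (F : fieldType) (n : nat) (z : F) (i k : 'I_n) :
  n.-primitive_root z ->
  \sum_(j < n) (z ^+ i / z ^+ k) ^+ j = (i == k)%:R * n%:R.
Proof.
move=> zP; have zn1 := prim_expr_order zP.
have z0 : z != 0 by rewrite (prim_root_eq0 zP) -lt0n; case: (i) => m /=; lia.
case: eqVneq => [->|ik].
  rewrite mul1r divff ?expf_neq0 // (eq_bigr (fun=> 1)) ?sumr_const ?card_ord //.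
  by move=> j _; rewrite expr1n.
rewrite mul0r; apply/eqP; set w := _ / _.
have w1 : w - 1 != 0.
  rewrite subr_eq0 /w; apply: contraNneq ik => e.
  have : z ^+ i == z ^+ k by rewrite -[z ^+ i](mulfVK (expf_neq0 k z0)) e mul1r.
  by rewrite (eq_prim_root_expr zP) !modn_small.
rewrite -(mulrI_eq0 _ (mulfI w1)) -subrX1 /w expr_div_n !(exprAC _ _ n) zn1.
by rewrite !expr1n divr1 subrr.
Qed.

Lemma prim_root_norm1 (C : numClosedFieldType) (n : nat) (z : C) :
  (0 < n)%N -> n.-primitive_root z -> `|z| = 1.
Proof.
move=> n0 zP; apply/eqP; rewrite -(@pexpr_eq1 _ _ n) -?lt0n //.
by rewrite -normrX (prim_expr_order zP) normr1.
Qed.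

(** On the unit circle conjugation is inversion, so expanding the squares gives a double sum whose
    off-diagonal terms vanish by orthogonality. *)
Lemma parseval_prim_root (C : numClosedFieldType) (n : nat) (z : C)
    (c : 'I_n -> C) : (0 < n)%N -> n.-primitive_root z ->
  \sum_(j < n) `|\sum_(i < n) c i * (z ^+ j) ^+ i| ^+ 2 =
  n%:R * \sum_(i < n) `|c i| ^+ 2.
Proof.
move=> n0 zP.
have z1 := prim_root_norm1 n0 zP.
have zJ : z^* = z^-1.
  by rewrite invC_norm z1 expr1n invr1 mul1r.
have sqE j : `|\sum_(i < n) c i * (z ^+ j) ^+ i| ^+ 2 =
    \sum_(i < n) \sum_(k < n) c i * (c k)^* * (z ^+ i / z ^+ k) ^+ j.
  rewrite normCK rmorph_sum /= big_distrlr /=.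
  apply: eq_bigr => i _; apply: eq_bigr => k _.
  rewrite !rmorphM !rmorphXn /= zJ mulrACA -!exprM !(mulnC j) !exprM.
  by rewrite -exprMn exprVn.
under eq_bigr => j _ do rewrite sqE.
rewrite exchange_big /= mulr_sumr; apply: eq_bigr => i _.
rewrite exchange_big /= (bigD1 i) //= [X in _ + X]big1 ?addr0 => [|k ki].
  by rewrite -mulr_sumr (sum_prim_root_exp _ _ zP) eqxx mul1r mulrC normCK.
by rewrite -mulr_sumr (sum_prim_root_exp _ _ zP) eq_sym (negPf ki) mul0r mulr0.
Qed.

(** At equally spaced points of the circle, multiplying by [P] scales each value by at most [K];
    Parseval carries this over to coefficients. Keeping only [n] coefficients of [P * X] lowers the
    left side, while [X] loses nothing. *)
Lemma poly_mul_circle_le (C : numClosedFieldType) (P X : {poly C}) (rho K : C) (n : nat) :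
  (size X <= n)%N -> (forall z, `|z| = `|rho| -> `|P.[z]| <= K) ->
  \sum_(i < n) `|(P * X)`_i| ^+ 2 * `|rho| ^+ i.*2 <=
  K ^+ 2 * \sum_(i < n) `|X`_i| ^+ 2 * `|rho| ^+ i.*2.
Proof.
move=> Xn PK.
have K0 : 0 <= K by apply: le_trans (PK rho erefl).
(* [N] exceeds the degrees of both [X] and [P * X], so Parseval sees each coefficient separately,
   without aliasing modulo [N]. *)
pose N := (n + size (P * X)).+1.
have N0 : (0 < N)%N by [].
have [z zP] := closed_prim_root_exists C N0.
have z1 := prim_root_norm1 N0 zP.
have hornerN (Y : {poly C}) (j : nat) : (size Y <= N)%N ->
    Y.[rho * z ^+ j] = \sum_(i < N) (Y`_i * rho ^+ i) * (z ^+ j) ^+ i.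
  move=> YN; rewrite (horner_coef_wide _ YN); apply: eq_bigr => i _.
  by rewrite exprMn mulrA.
have parseval (Y : {poly C}) : (size Y <= N)%N ->
    \sum_(j < N) `|Y.[rho * z ^+ j]| ^+ 2 =
    N%:R * \sum_(i < N) `|Y`_i| ^+ 2 * `|rho| ^+ i.*2.
  move=> YN; under eq_bigr => j _ do rewrite hornerN //.
  rewrite (parseval_prim_root _ N0 zP); congr (_ * _); apply: eq_bigr => i _.
  by rewrite normrM normrX exprMn -exprM muln2.
have widen (m : nat) (Y : {poly C}) : (m <= N)%N ->
    \sum_(i < m) `|Y`_i| ^+ 2 * `|rho| ^+ i.*2 <=
    \sum_(i < N) `|Y`_i| ^+ 2 * `|rho| ^+ i.*2.
  move=> mN; rewrite (big_ord_widen N (fun i => `|Y`_i| ^+ 2 * `|rho| ^+ i.*2) mN).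
  rewrite [leRHS](bigID (fun i : 'I_N => (i < m)%N)) /= lerDl.
  by apply: sumr_ge0 => i _; rewrite mulr_ge0 ?exprn_ge0.
have -> : \sum_(i < n) `|X`_i| ^+ 2 * `|rho| ^+ i.*2 =
    \sum_(i < N) `|X`_i| ^+ 2 * `|rho| ^+ i.*2.
  rewrite (@big_ord_widen _ _ _ n N (fun i => `|X`_i| ^+ 2 * `|rho| ^+ i.*2)); last first.
    by rewrite /N; lia.
  rewrite big_mkcond; apply: eq_bigr => i _; case: ltnP => // ni.
  by rewrite nth_default ?(leq_trans Xn) // normr0 expr0n mul0r.
apply: le_trans (widen _ _ _) _; first by rewrite /N; lia.
rewrite -(ler_pM2l (_ : 0 < N%:R)) ?ltr0n // mulrCA -!parseval; try by rewrite /N; lia.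
rewrite mulr_sumr; apply: ler_sum => j _.
rewrite hornerM normrM exprMn ler_wpM2r ?exprn_ge0 // lerXn2r ?nnegrE //.
by apply: PK; rewrite normrM normrX z1 expr1n mulr1.
Qed.

(** * Bounded power series on a disc and convolution with their coefficients *)

(** One-sided continuity at each endpoint. It serves twice in [conv_circle_le]: to lower a bound to
    its infimum and to raise a radius to that of the disc. *)
Lemma horner_ge0_itvoo (R : realType) (p : {poly R}) (a b : R) : a < b ->
  (forall t, a < t < b -> 0 <= p.[t]) -> 0 <= p.[a] /\ 0 <= p.[b].
Proof.
move=> ab p0; have cp : continuous (horner p) by exact: continuous_horner.
split.
- apply: (@closed_cvg _ _ a^'+ _ (horner p) (fun y => 0 <= y)) => //.
  + by near=> t; apply: p0; apply/andP; split; near: t;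
      [exact: nbhs_right_gt|exact: nbhs_right_lt].
  + by apply: cvg_at_right_filter; exact: cp.
- apply: (@closed_cvg _ _ b^'- _ (horner p) (fun y => 0 <= y)) => //.
  + by near=> t; apply: p0; apply/andP; split; near: t;
      [exact: nbhs_left_gt|exact: nbhs_left_lt].
  + by apply: cvg_at_left_filter; exact: cp.
Unshelve. all: by end_near. Qed.

Section PowerSeries.
Local Open Scope complex_scope.
Variable R : realType.
Local Notation normc := (@Normc.normc R).

Lemma normr_normc (x : R[i]) : `|x| = (normc x)%:C.
Proof. by case: x => a b; rewrite normc_def. Qed.

Lemma normc_ge0 (x : R[i]) : 0 <= normc x.
Proof. by case: x => a b; rewrite sqrtr_ge0. Qed.

Lemma normc_real (x : R) : 0 <= x -> normc x%:C = x.
Proof. by move=> x0; rewrite /= expr0n addr0 sqrtr_sqr ger0_norm. Qed.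

Lemma normcX (x : R[i]) n : normc (x ^+ n) = normc x ^+ n.
Proof.
elim: n => [|n IH]; first by rewrite !expr0 Normc.normc1.
by rewrite !exprS Normc.normcM IH.
Qed.

Lemma normc_triangle (x y : R[i]) : normc (x + y) <= normc x + normc y.
Proof. exact: (le_normcD (x : Rcomplex R) y). Qed.

Lemma normc_sum (I : Type) (r : seq I) (P : pred I) (F : I -> R[i]) :
  normc (\sum_(i <- r | P i) F i) <= \sum_(i <- r | P i) normc (F i).
Proof.
elim/big_ind2 : _ => //; first by rewrite Normc.normc0.
by move=> x1 x2 y1 y2 h1 h2; rewrite (le_trans (normc_triangle _ _)) ?lerD.
Qed.

Variable phihat : nat -> R[i].

(** The terms of a convergent series tend to zero, hence are at most 1 from some [N] on; [B] adds to
    1 the finitely many terms before [N]. *)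
Lemma power_series_term_bounded (r : R) :
  0 <= r -> cvgn (power_series phihat r%:C) ->
  exists2 B : R, 0 <= B & forall k, normc (phihat k) * r ^+ k <= B.
Proof.
move=> r0 /cvg_series_cvg_0 cv.
have /cvgrPdist_le /(_ _ (@ltr01 R[i])) [N _ NP] := cv.
have termE k : normc (phihat k * r%:C ^+ k) = normc (phihat k) * r ^+ k.
  by rewrite Normc.normcM normcX normc_real.
exists (1 + \sum_(k < N) normc (phihat k) * r ^+ k).
  by rewrite addr_ge0 // sumr_ge0 // => k _; rewrite mulr_ge0 ?normc_ge0 ?exprn_ge0.
move=> k; have [kN|Nk] := ltnP k N.
  rewrite (bigD1 (Ordinal kN)) //= addrCA lerDl addr_ge0 // sumr_ge0 // => i _.
  by rewrite mulr_ge0 ?normc_ge0 ?exprn_ge0.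
have := NP k Nk; rewrite /= sub0r normrN normr_normc lecR termE => /le_trans; apply.
by rewrite lerDl sumr_ge0 // => i _; rewrite mulr_ge0 ?normc_ge0 ?exprn_ge0.
Qed.

Lemma power_sum_approx (z : R[i]) (e : R) (m : nat) :
  cvgn (power_series phihat z) -> 0 < e ->
  exists2 L, (m <= L)%N &
    normc (power_sum phihat z - power_series phihat z L) <= e.
Proof.
move=> cv e0.
have e0' : 0 < e%:C :> R[i] by rewrite ltcR.
have /cvgrPdist_le /(_ _ e0') [N _ NP] := cv.
exists (maxn m N); first exact: leq_maxl.
have := NP (maxn m N) (leq_maxr _ _).
by rewrite normr_normc lecR.
Qed.

(** Geometric tail of ratio [rho / r]. The bound involves neither [L] nor the argument of [z], so it
    is uniform on the circle. *)
Lemma power_series_sub_le (B r rho : R) (z : R[i]) (m L : nat) :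
  0 <= B -> (forall k, normc (phihat k) * r ^+ k <= B) ->
  0 <= rho < r -> normc z = rho -> (m <= L)%N ->
  normc (power_series phihat z L - power_series phihat z m) <=
  B / (1 - rho / r) * (rho / r) ^+ m.
Proof.
move=> B0 Bk /andP[rho0 rhor] zrho mL.
have r0 : 0 < r by exact: le_lt_trans rhor.
set q := rho / r; have q0 : 0 <= q by rewrite divr_ge0 // ltW.
have q1 : q < 1 by rewrite ltr_pdivrMr // mul1r.
rewrite /power_series /series /= (big_cat_nat (leq0n m) mL) //= addrAC subrr add0r.
apply: le_trans (normc_sum _ _ _) _.
have termB k : normc (phihat k * z ^+ k) <= B * q ^+ k.
  rewrite Normc.normcM normcX zrho -[rho](divfK (lt0r_neq0 r0)) -/q exprMn.
  by rewrite mulrCA mulrC ler_wpM2r ?exprn_ge0.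
apply: le_trans (ler_sum _ (fun k _ => termB k)) _.
rewrite -(subnKC mL) -{1}[m]add0n big_addn addKn big_mkord.
under eq_bigr => i _ do rewrite exprD mulrA.
rewrite -mulr_suml -mulr_sumr.
suff : \sum_(i < L - m) q ^+ i <= (1 - q)^-1.
  by move=> h; rewrite ler_wpM2r ?exprn_ge0 // ler_wpM2l.
rewrite -[leRHS]mul1r ler_pdivlMr ?subr_gt0 // mulrC.
by rewrite -opprB mulNr -subrX1 opprB gerBl exprn_ge0.
Qed.

(** The hypotheses give pointwise convergence only; on a circle strictly inside the disc the
    geometric tail makes it uniform, so one [m] serves all [z]. *)
Lemma power_series_le_on_circle (s C rho e : R) :
  (forall z, normc z < s -> cvgn (power_series phihat z)) ->
  (forall z, normc z < s -> normc (power_sum phihat z) <= C) ->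
  0 <= rho < s -> 0 < e ->
  \forall m \near \oo, forall z, normc z = rho ->
    normc (power_series phihat z m) <= C + e.
Proof.
(* A radius strictly between [rho] and [s]: convergence at [r] bounds the coefficients, and
   [rho / r < 1] makes the tail geometric. *)
move=> cv leC /andP[rho0 rhos] e0; pose r := (rho + s) / 2.
have rhor : rho < r by rewrite midf_lt.
have rs : r < s by rewrite midf_lt.
have r0 : 0 <= r by rewrite ltW // (le_lt_trans rho0).
have [|B B0 Bk] := power_series_term_bounded r0; first by apply: cv; rewrite normc_real.
have q1 : `|rho / r| < 1.
  by rewrite (ger0_norm (divr_ge0 rho0 r0)) ltr_pdivrMr ?mul1r // (le_lt_trans rho0).
have e2 : 0 < e / 2 by rewrite divr_gt0.
have qm : (B / (1 - rho / r) * (rho / r) ^+ m @[m --> \oo] --> (0 : R)).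
  by rewrite -[X in _ --> X](mulr0 (B / (1 - rho / r))); apply: cvgMr; exact: cvg_expr.
have /cvgrPdist_le /(_ _ e2) := qm.
apply: filterS => m; rewrite sub0r normrN => /(le_trans (ler_norm _)) hm z zrho.
have zs : normc z < s by rewrite zrho.
(* [L] may depend on [z], since the estimate from [m] to [L] does not involve [L]; each of the two
   errors takes half of [e]. *)
have [L mL hL] := power_sum_approx m (cv z zs) e2.
have hLm := power_series_sub_le B0 Bk (introT andP (conj rho0 rhor)) zrho mL.
have -> : power_series phihat z m = power_sum phihat z
    + (- (power_sum phihat z - power_series phihat z L)
    + - (power_series phihat z L - power_series phihat z m)).
  by rewrite !opprB addrA addrACA; ring.
have N x : normc (- x) = normc x by exact: (normcN (x : Rcomplex R)).
apply: le_trans (normc_triangle _ _) _; apply: lerD; first exact: leC.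
apply: le_trans (normc_triangle _ _) _; rewrite !N.
by rewrite [leRHS](splitr e) lerD // (le_trans hLm).
Qed.

(** The sequence [x] cut at [n] becomes a polynomial, and a truncation of the power series becomes
    the multiplier in [poly_mul_circle_le]. *)
Lemma conv_circle_le (s C : R) (x : nat -> R[i]) (n : nat) : 0 < s ->
  (forall z, normc z < s -> cvgn (power_series phihat z)) ->
  (forall z, normc z < s -> normc (power_sum phihat z) <= C) ->
  \sum_(i < n) normc (\sum_(k < i.+1) phihat k * x (i - k)%N) ^+ 2 * s ^+ i.*2 <=
  C ^+ 2 * \sum_(i < n) normc (x i) ^+ 2 * s ^+ i.*2.
Proof.
move=> s0 cv leC.
pose X : {poly R[i]} := \poly_(i < n) x i.
(* Both sides are written as polynomials in the radius, so that [horner_ge0_itvoo] can take the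
   limit. *)
pose lhs := \sum_(i < n)
  (normc (\sum_(k < i.+1) phihat k * x (i - k)%N) ^+ 2)%:P * 'X^(i.*2).
pose rhs := (C ^+ 2)%:P * \sum_(i < n) (normc (x i) ^+ 2)%:P * 'X^(i.*2).
have lhsE t : lhs.[t] =
    \sum_(i < n) normc (\sum_(k < i.+1) phihat k * x (i - k)%N) ^+ 2 * t ^+ i.*2.
  by rewrite horner_sum; apply: eq_bigr => i _; rewrite !hornerE.
have rhsE t : rhs.[t] = C ^+ 2 * \sum_(i < n) normc (x i) ^+ 2 * t ^+ i.*2.
  by rewrite !hornerE horner_sum; congr (_ * _); apply: eq_bigr => i _; rewrite !hornerE.
rewrite -lhsE -rhsE.
(* Two limits: the bound on [|z| = rho] for truncations is any [t > C], then
   [t] decreases to [C] and [rho] increases to [s]. *)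
have inside rho : 0 < rho < s -> lhs.[rho] <= rhs.[rho].
  move=> /andP[rho0 rhos]; have rhoI : 0 <= rho < s by rewrite (ltW rho0).
  (* Here the polynomial variable is the bound, with [rho] fixed; [C + 1] is an arbitrary right
     end. *)
  have [] := @horner_ge0_itvoo R
    ('X^2 * (\sum_(i < n) normc (x i) ^+ 2 * rho ^+ i.*2)%:P - lhs.[rho]%:P) C (C + 1).
  - by rewrite ltrDl.
  - move=> t /andP[Ct _]; rewrite !hornerE subr_ge0.
    have e0 : 0 < t - C by rewrite subr_gt0.
    have [N _ NP] := power_series_le_on_circle cv leC rhoI e0.
    (* [m >= N] gives the bound on the circle; [m >= n] keeps the first [n] convolution coefficients
       exact. *)
    pose m := maxn n N.
    pose P : {poly R[i]} := \poly_(k < m) phihat k.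
    have PK (z : R[i]) : `|z| = `|rho%:C| -> `|P.[z]| <= t%:C.
      rewrite !normr_normc => /complexI; rewrite (normc_real (ltW rho0)) => zrho.
      have := NP m (leq_maxr _ _) z zrho; rewrite addrC subrK lecR.
      by rewrite /power_series /series /= horner_poly big_mkord.
    have := poly_mul_circle_le (size_poly n x) PK.
    have sumE (y : nat -> R[i]) :
        \sum_(i < n) `|y i| ^+ 2 * `|rho%:C| ^+ i.*2 =
        (\sum_(i < n) normc (y i) ^+ 2 * rho ^+ i.*2)%:C.
      rewrite rmorph_sum; apply: eq_bigr => i _.
      by rewrite !normr_normc (normc_real (ltW rho0)) !rmorphM !rmorphXn.
    rewrite !sumE -rmorphXn -rmorphM lecR => PX.
    have -> : lhs.[rho] = \sum_(i < n) normc (P * X)`_i ^+ 2 * rho ^+ i.*2.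
      rewrite lhsE; apply: eq_bigr => i _; rewrite coefM.
      congr (normc _ ^+ 2 * _); apply: eq_bigr => k _; rewrite !coef_poly.
      rewrite (leq_trans (ltn_ord k)) ?(leq_trans (ltn_ord i)) ?leq_maxl //.
      by rewrite (leq_ltn_trans (leq_subr _ _)).
    apply: le_trans PX _; rewrite ler_wpM2l ?sqr_ge0 // ler_sum // => i _.
    by rewrite coef_poly ltn_ord.
  by rewrite rhsE => + _; rewrite !hornerE subr_ge0.
have [] := @horner_ge0_itvoo R (rhs - lhs) 0 s s0.
  by move=> t /inside; rewrite hornerD hornerN subr_ge0.
by move=> _; rewrite hornerD hornerN subr_ge0.
Qed.
End PowerSeries.

(** * Parents, depth and path weights in a rooted directed tree *)

Section Tree.
Variables (V : choiceType) (T : rooted_directed_tree V).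
Local Notation root := (troot T).
Local Notation par := (par T).

Lemma edge_neq_root u v : edge T u v -> v != root.
Proof. by apply: contraTneq => ->; exact: root_parentless. Qed.

Lemma par_edge u v : edge T u v -> par v = u.
Proof.
move=> uv; have [w [wv wu]] := parent_unique (edge_neq_root uv).
by apply: xget_unique => // y yv; rewrite -(wu _ uv); apply/esym/wu.
Qed.

Lemma edge_par v : v != root -> edge T (par v) v.
Proof.
by move=> vr; have [w [wv _]] := parent_unique vr; rewrite (par_edge wv).
Qed.

(** The first conjunct excludes the root, which [par] sends to itself. *)
Lemma childrenP u v : children T u v <-> v != root /\ par v = u.
Proof.
split=> [uv|[vr <-]]; last exact: edge_par.
by split; [exact: edge_neq_root uv|exact: par_edge].
Qed.

(** Connectedness gives an undirected walk from the root to [v]. Reaching the root by iterating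
    [par] is preserved along it: an edge walked downwards adds one iteration, an edge walked upwards
    removes one. *)
Lemma iter_par_eq_root v : exists n, iter n par v == root.
Proof.
suff walk p u : (exists n, iter n par u == root) ->
    path [rel x y | edge T x y || edge T y x] u p ->
    exists n, iter n par (last u p) == root.
  have [p rp <-] := tree_connected T root v.
  by apply: walk rp; exists 0%N.
elim: p u => [//|w p IH] u /= [n nu] /andP[uw pw]; apply: IH pw.
case/orP: uw => [/par_edge wu|uw]; first by exists n.+1; rewrite iterSr wu.
case: n nu => [/eqP /= ur|n]; last by rewrite iterSr (par_edge uw); exists n.
by have := root_parentless T w; rewrite -ur uw.
Qed.

Lemma depth_unique v n : iter n par v = root ->
  (forall j, (j < n)%N -> iter j par v != root) -> depth T v = n.
Proof.
move=> nv jv; apply: xget_unique => // m [mv km].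
have [mn|nm|//] := ltngtP m n.
- by have := jv m mn; rewrite mv eqxx.
- by have := km n nm; rewrite nv eqxx.
Qed.

(** The least hitting time of the root meets both clauses of [gen], so the value of [depth] is never
    the default of [xget] for want of a witness. *)
Lemma depthP v : iter (depth T v) par v = root /\
  forall j, (j < depth T v)%N -> iter j par v != root.
Proof.
pose n := ex_minn (iter_par_eq_root v).
have [nv jv] : iter n par v = root /\ forall j, (j < n)%N -> iter j par v != root.
  rewrite /n; case: ex_minnP => m /eqP mv mj; split=> // j.
  by apply: contraTneq => /eqP/mj; rewrite -leqNgt.
by rewrite (depth_unique nv jv).
Qed.

Lemma depth_root : depth T root = 0%N.
Proof. exact: depth_unique. Qed.

Lemma depth_par v : v != root -> depth T v = (depth T (par v)).+1.
Proof.
move=> vr; have [nv jv] := depthP (par v); apply: depth_unique.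
  by rewrite iterSr.
by case=> [|j] // /jv; rewrite -iterSr.
Qed.

Lemma depth_eq0 v : (depth T v == 0%N) = (v == root).
Proof.
have [->|vr] := eqVneq v root; first by rewrite depth_root.
by rewrite depth_par.
Qed.

Lemma depth_iter k v : (k <= depth T v)%N -> depth T (iter k par v) = (depth T v - k)%N.
Proof.
elim: k => [|k IH] kv; first by rewrite subn0.
have := IH (ltnW kv); rewrite iterS => dk.
have : iter k par v != root by have [_] := depthP v; apply.
by move=> /depth_par; rewrite dk; lia.
Qed.

(** Another candidate [m] cannot exceed the depth of [v], or the path would pass through the root;
    comparing depths then gives [m = k]. *)
Lemma gen_iter k v : (k <= depth T v)%N -> gen T (iter k par v) v = k.
Proof.
move=> kv; have [nv jv] := depthP v.
apply: xget_unique => [|m [mk jm]].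
  by split=> // j jk; apply: jv; exact: leq_trans jk kv.
have mv : (m <= depth T v)%N.
  by rewrite leqNgt; apply/negP => /jm; rewrite nv eqxx.
by have := congr1 (depth T) mk; rewrite !depth_iter //; lia.
Qed.

Section Weights.
Variables (R : realType) (lambda : V -> R).
Hypothesis lambda_gt0 : forall v, v != root -> 0 < lambda v.
Local Notation L := (lambda_path T lambda root).

Lemma lambda_path_iterE k v : (k <= depth T v)%N ->
  lambda_path T lambda (iter k par v) v = \prod_(0 <= j < k) lambda (iter j par v).
Proof. by move=> kv; rewrite /lambda_path gen_iter. Qed.

Lemma lambda_path_iter_gt0 k v : (k <= depth T v)%N ->
  0 < lambda_path T lambda (iter k par v) v.
Proof.
move=> kv; rewrite lambda_path_iterE // big_mkord prodr_gt0 // => j _.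
by apply: lambda_gt0; have [_] := depthP v; apply; exact: leq_trans kv.
Qed.

Lemma lambda_path_root_gt0 v : 0 < L v.
Proof.
by have [vr _] := depthP v; rewrite -{1}vr; exact: lambda_path_iter_gt0.
Qed.

Lemma lambda_path_rootE k v : (k <= depth T v)%N ->
  L v = lambda_path T lambda (iter k par v) v * L (iter k par v).
Proof.
have LE w : L w = \prod_(0 <= j < depth T w) lambda (iter j par w) by [].
move=> kv; rewrite (lambda_path_iterE kv) !LE depth_iter //.
rewrite (big_cat_nat (leq0n k) kv) /=; congr (_ * _).
rewrite -{1}[k]add0n big_addn; apply: eq_bigr => j _.
by rewrite iterD.
Qed.

Lemma lambda_path_rootS v : v != root -> L v = lambda v * L (par v).
Proof.
move=> vr; have v1 : (1 <= depth T v)%N by rewrite depth_par.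
by rewrite (lambda_path_rootE v1) lambda_path_iterE // big_nat1.
Qed.
End Weights.
End Tree.

(** * From inequalities on paths to inequalities on the tree, by superharmonic weights *)

Section Majorization.
Variables (R : realType) (V : choiceType).

Lemma esumZl_le (S : set V) (c : R) (a : V -> \bar R) : 0 <= c ->
  (forall v, 0 <= a v)%E ->
  (\esum_(v in S) (c%:E * a v) <= c%:E * \esum_(v in S) a v)%E.
Proof.
move=> c0 a0; apply: ge_ereal_sup => _ [A [fA AS] <-].
rewrite -ge0_mule_fsumr //.
by rewrite lee_wpmul2l ?lee_fin //; apply: esum_ge; exists A.
Qed.

Variable T : rooted_directed_tree V.
Local Notation par := (par T).

Let path_sum (g : V -> R) (v : V) : R :=
  \sum_(k < (depth T v).+1) g (iter k par v).

Let path_sum_par g v : v != troot T -> path_sum g v = g v + path_sum g (par v).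
Proof.
move=> vr; rewrite /path_sum depth_par // big_ord_recl /=; congr (_ + _).
by apply: eq_bigr => k _; rewrite -iterS iterSr.
Qed.

Let path_sum_root g : path_sum g (troot T) = g (troot T).
Proof. by rewrite /path_sum depth_root big_ord1. Qed.

Let level n : set V := [set v | depth T v = n].

Let level0 : level 0 = [set troot T].
Proof.
apply/seteqP; split=> [v /= /eqP|v /= ->]; last exact: depth_root.
by rewrite depth_eq0 => /eqP.
Qed.

(** Level [n.+1] is the disjoint union of the sets of children of level [n]; the reindexing sends a
    pair (vertex, child) to the child, with inverse [v] to [(par v, v)]. *)
Let esum_levelS n (a : V -> \bar R) : (forall v, 0 <= a v)%E ->
  (\esum_(v in level n.+1) a v =
   \esum_(u in level n) \esum_(v in children T u) a v)%E.
Proof.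
move=> a0; rewrite esum_esum //.
apply: (reindex_esum (level n `*`` children T) (level n.+1) snd a).
split.
- move=> [u v] /= [<- /childrenP[vr <-]]; exact: depth_par.
- move=> [u v] [u' v'] /set_mem/= [_ /childrenP[_ <-]].
  by move=> /set_mem/= [_ /childrenP[_ <-]] ->.
- move=> v /= vn; have vr : v != troot T by rewrite -depth_eq0 vn.
  exists (par v, v) => //=; split; last by apply/childrenP.
  by move: vn; rewrite /level /= depth_par // => -[].
Qed.

(** Summation by parts, level by level: the slack [D] of the path inequality satisfies
    [g v + D v = D (par v) + h v] off the root, so [D] is handed down from each level to the
    next. *)
Lemma tree_majorization (g h mu : V -> R) :
  (forall v, 0 <= g v) -> (forall v, 0 <= h v) -> (forall v, 0 <= mu v) ->
  (forall u, (\esum_(v in children T u) (mu v)%:E <= (mu u)%:E)%E) ->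
  (forall v, \sum_(k < (depth T v).+1) g (iter k par v) <=
             \sum_(k < (depth T v).+1) h (iter k par v)) ->
  (\esum_(v in [set: V]) (g v * mu v)%:E <=
   \esum_(v in [set: V]) (h v * mu v)%:E)%E.
Proof.
move=> g0 h0 mu0 mu_chi gh.
pose D v := path_sum h v - path_sum g v.
have D0 v : 0 <= D v by rewrite subr_ge0; exact: gh.
have DE v : v != troot T -> g v + D v = D (par v) + h v.
  by move=> vr; rewrite /D !(path_sum_par _ vr); ring.
have muM0 (f : V -> R) : (forall v, 0 <= f v) -> forall v, (0 <= (f v * mu v)%:E)%E.
  by move=> f0 v; rewrite lee_fin mulr_ge0.
pose I (f : V -> R) n : \bar R := (\esum_(v in level n) (f v * mu v)%:E)%E.
have ID (f1 f2 f : V -> R) n : (forall v, 0 <= f1 v) -> (forall v, 0 <= f2 v) ->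
    {in level n, forall v, f v = f1 v + f2 v} -> I f n = (I f1 n + I f2 n)%E.
  move=> f10 f20 fE; rewrite /I -esumD => [|v _|v _]; try exact: muM0.
  by apply: eq_esum => v vn; rewrite fE ?inE // mulrDl EFinD.
(* Superharmonicity enters here: [f \o par] is constant on each set of children and factors out of
   the sum over it. *)
have I_par (f : V -> R) n : (forall v, 0 <= f v) -> (I (f \o par) n.+1 <= I f n)%E.
  move=> f0; rewrite /I esum_levelS; last by apply: muM0 => v; exact: f0.
  apply: le_esum => u _.
  rewrite (eq_esum (b := fun v => ((f u)%:E * (mu v)%:E)%E)); last first.
    by move=> v /childrenP[_ /= ->]; rewrite EFinM.
  have mu0E v : (0 <= (mu v)%:E)%E by rewrite lee_fin.
  apply: le_trans (esumZl_le _ (f0 u) mu0E) _.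
  by rewrite EFinM lee_wpmul2l ?lee_fin.
(* Telescoping with the nonnegative slack [D] carried by the last level avoids
   subtracting possibly infinite sums. *)
have main n : (\sum_(0 <= i < n.+1) I g i + I D n <= \sum_(0 <= i < n.+1) I h i)%E.
  elim: n => [|n IH].
    rewrite !big_nat1 -(ID g D h) // => v; rewrite inE level0 => /= ->.
    by rewrite /D !path_sum_root addrC subrK.
  rewrite big_nat_recr //= [leRHS]big_nat_recr //= -addeA.
  rewrite -(ID g D (fun v => g v + D v)) //.
  rewrite (ID (D \o par) h) //=; last first.
    by move=> v; rewrite inE => vn; rewrite DE // -depth_eq0 vn.
  rewrite addeA leeD2r //; apply: le_trans IH; rewrite leeD2l //; exact: I_par.
have IT (f : V -> R) : (forall v, 0 <= f v) ->
    (\esum_(v in [set: V]) (f v * mu v)%:E = \sum_(0 <= i <oo) I f i)%E.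
  move=> f0; rewrite nneseries_esumT; last by move=> n; apply: esum_ge0 => v _; exact: muM0.
  rewrite -esum_bigcupT; last exact: muM0.
    congr (esum _ _); apply/esym/seteqP; split=> // v _.
    by exists (depth T v).
  by move=> i j _ _ [v [/= <- <-]].
rewrite !IT //; apply: lee_lim.
- by apply: is_cvg_nneseries => n _ _; apply: esum_ge0 => v _; exact: muM0.
- by apply: is_cvg_nneseries => n _ _; apply: esum_ge0 => v _; exact: muM0.
(* [main] covers at least one level, so the empty partial sum is separate; otherwise the nonnegative
   [I D n] is dropped. *)
- apply: nearW => -[|n]; first by rewrite !big_geq.
  apply: le_trans (main n); rewrite leeDl //.
  by apply: esum_ge0 => v _; exact: muM0.
Qed.
End Majorization.

(** * Norm estimates for the weighted shift and for [Gamma] *)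

Section Bounds.
Local Open Scope complex_scope.
Variables (R : realType) (V : choiceType) (T : rooted_directed_tree V).
Variables (beta lambda : V -> R).
Hypothesis beta_gt0 : forall v, 0 < beta v.
Hypothesis lambda_gt0 : forall v, v != troot T -> 0 < lambda v.
Local Notation normc := (@Normc.normc R).
Local Notation par := (par T).
Local Notation L := (lambda_path T lambda (troot T)).
Local Notation A := (wshift T beta lambda).

Lemma l2sum_ge0 (f : V -> R[i]) : (0 <= l2sum beta f)%E.
Proof. by apply: esum_ge0 => v _; rewrite lee_fin mulr_ge0 ?sqr_ge0 ?ltW. Qed.

(** The zero function keeps the supremum from being the one over the empty set, which is [-oo]. *)
Lemma opnorm_ge0 (B : operator R V) :
  (forall f, l2 beta f -> dom B f) -> (0 <= opnorm beta B)%E.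
Proof.
move=> Bdom; have l2sum0 : l2sum beta (fun=> 0) = 0%E.
  by apply: esum1 => v _; rewrite Normc.normc0 expr0n mul0r.
apply: le_trans (_ : (l2norm beta (act B (fun=> 0)))%:E <= _)%E.
  by rewrite lee_fin sqrtr_ge0.
apply: ereal_sup_ubound; exists (fun=> 0) => //; split.
  by apply: Bdom; rewrite /l2 /= l2sum0.
by rewrite /l2norm l2sum0 sqrtr0.
Qed.

Lemma l2sum_fin_num (f : V -> R[i]) : l2 beta f -> l2sum beta f \is a fin_num.
Proof. by move=> fl2; rewrite ge0_fin_numE ?l2sum_ge0. Qed.

Lemma l2normE (f : V -> R[i]) : l2 beta f -> ((l2norm beta f) ^+ 2)%:E = l2sum beta f.
Proof.
by move=> fl2; rewrite sqr_sqrtr ?fine_ge0 ?l2sum_ge0 // fineK // l2sum_fin_num.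
Qed.

Lemma l2sum_support (S : set V) (f : V -> R[i]) : (forall v, ~ S v -> f v = 0) ->
  l2sum beta f = (\esum_(v in S) (normc (f v) ^+ 2 * beta v)%:E)%E.
Proof.
move=> fS; rewrite [RHS]esum_mkcond; apply: eq_esum => v _.
case: ifPn => // /negP; rewrite inE => vS.
by rewrite fS // Normc.normc0 expr0n mul0r.
Qed.

(** The shift is tested on [d], the indicator of [u] scaled by [c] to norm 1; its image lives on the
    children of [u]. Rescaled by path weights and powers of [s], the conclusion is the
    superharmonicity used later. *)
Lemma opnorm_wshift_children (s : R) (u : V) :
  dom A = l2 beta -> opnorm beta A = s%:E ->
  0 <= s /\
  (\esum_(v in children T u) (lambda v ^+ 2 * beta v)%:E <= (s ^+ 2 * beta u)%:E)%E.
Proof.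
move=> Adom As; pose c := (Num.sqrt (beta u))^-1.
have c2 : c ^+ 2 * beta u = 1.
  by rewrite exprVn sqr_sqrtr ?ltW // mulVf ?gt_eqF.
have c0 : 0 <= c by rewrite invr_ge0 sqrtr_ge0.
pose d (v : V) : R[i] := if v == u then c%:C else 0.
have d1 : l2sum beta d = 1%E.
  rewrite (@l2sum_support [set u]) => [|v /eqP vu]; last by rewrite /d (negPf vu).
  rewrite esum_set1 /d ?eqxx normc_real // ?c2 //.
have dl2 : l2 beta d by rewrite /l2 /= d1 ltry.
have [_ Adl2] : dom A d by rewrite Adom.
have Ad : l2norm beta (act A d) <= s.
  rewrite -lee_fin -As; apply: ereal_sup_ubound; exists d => //; split.
    by rewrite Adom.
  by rewrite /l2norm d1 sqrtr1.
have s0 : 0 <= s by apply: le_trans Ad; rewrite sqrtr_ge0.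
split=> //.
have AdE : l2sum beta (act A d) =
    (\esum_(v in children T u) ((c ^+ 2) * (lambda v ^+ 2 * beta v))%:E)%E.
  rewrite (@l2sum_support (children T u)) => [|v uv] /=.
    apply: eq_esum => v /childrenP[vr vu].
    rewrite (negPf vr) /d vu eqxx -rmorphM normc_real ?mulr_ge0 ?(ltW (lambda_gt0 _)) //.
    by rewrite exprMn mulrAC mulrC.
  case: eqP => // /eqP vr; rewrite /d; case: eqP => [vu|_]; last by rewrite mulr0.
  by case: uv; apply/childrenP.
have : (l2sum beta (act A d) <= (s ^+ 2)%:E)%E.
  by rewrite -l2normE // lee_fin lerXn2r ?nnegrE ?sqrtr_ge0.
rewrite AdE => le_s.
have lb0 v : (0 <= (c ^+ 2 * (lambda v ^+ 2 * beta v))%:E)%E.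
  by rewrite lee_fin mulr_ge0 ?sqr_ge0 // mulr_ge0 ?sqr_ge0 // ltW.
rewrite (eq_esum (b := fun v => ((beta u)%:E *
    (c ^+ 2 * (lambda v ^+ 2 * beta v))%:E)%E)); last first.
  by move=> v _; rewrite -EFinM mulrA (mulrC (beta u)) c2 mul1r.
apply: le_trans (esumZl_le _ (ltW (beta_gt0 u)) lb0) _.
by rewrite mulrC EFinM lee_wpmul2l // lee_fin ltW.
Qed.

(** Leaflessness gives the root a child, whose positive term forces [s] to be nonzero. This allows
    division by powers of [s] and puts 0 in the disc. *)
Lemma opnorm_wshift_gt0 (s : R) : leafless T ->
  dom A = l2 beta -> opnorm beta A = s%:E -> 0 < s.
Proof.
move=> leaf Adom As; have [v rv] := leaf (troot T).
have [s0 chi] := opnorm_wshift_children (troot T) Adom As.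
rewrite lt_neqAle s0 andbT; apply/eqP => s_eq0.
have /childrenP[vr _] := rv.
have le_chi : ((lambda v ^+ 2 * beta v)%:E <=
    \esum_(v in children T (troot T)) (lambda v ^+ 2 * beta v)%:E)%E.
  apply: esum_ge; exists [set v]; last by rewrite fsbig_set1.
  by split=> // _ ->.
have := le_trans le_chi chi.
by rewrite -s_eq0 expr0n mul0r lee_fin leNgt mulr_gt0 // exprn_gt0 // lambda_gt0.
Qed.

(** [L v] factors through every ancestor of [v], so dividing by [L] removes the tree weights and
    leaves a plain convolution along the path. *)
Lemma Gamma_path (phihat : nat -> R[i]) (f : V -> R[i]) (v : V) :
  Gamma T lambda phihat f v / (L v)%:C =
  \sum_(k < (depth T v).+1) phihat k * (f (iter k par v) / (L (iter k par v))%:C).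
Proof.
rewrite /Gamma big_mkord mulr_suml; apply: eq_bigr => k _.
have kv : (k <= depth T v)%N by rewrite -ltnS.
have L0 w : (L w)%:C != 0.
  by rewrite eq_complex /= eqxx andbT gt_eqF // (lambda_path_root_gt0 lambda_gt0).
have l0 : (lambda_path T lambda (iter k par v) v)%:C != 0.
  by rewrite eq_complex /= eqxx andbT gt_eqF // (lambda_path_iter_gt0 lambda_gt0).
rewrite (lambda_path_rootE lambda kv) rmorphM /=.
have := L0 (iter k par v); move: l0.
by move: (L _) (lambda_path _ _ _ _) => a b ? ?; field; apply/andP.
Qed.

Lemma l2sum_Gamma_le (phihat : nat -> R[i]) (s C : R) (f : V -> R[i]) : 0 < s ->
  (forall u, (\esum_(v in children T u) (lambda v ^+ 2 * beta v)%:E <=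
    (s ^+ 2 * beta u)%:E)%E) ->
  (forall z, normc z < s -> cvgn (power_series phihat z)) ->
  (forall z, normc z < s -> normc (power_sum phihat z) <= C) ->
  (l2sum beta (Gamma T lambda phihat f) <= (C ^+ 2)%:E * l2sum beta f)%E.
Proof.
move=> s0 chi cv leC.
have L0 v : 0 < L v := lambda_path_root_gt0 lambda_gt0 v.
have ncL v : normc (L v)%:C = L v by rewrite normc_real // ltW.
(* The summand of [l2sum] is split as [nrm * mu]: [nrm] is the quantity that [conv_circle_le]
   controls on paths, [mu] the superharmonic weight. *)
pose nrm (y : V -> R[i]) v := normc (y v / (L v)%:C) ^+ 2 * s ^+ (depth T v).*2.
pose mu v := L v ^+ 2 * beta v / s ^+ (depth T v).*2.
have nrm0 y v : 0 <= nrm y v by rewrite mulr_ge0 ?sqr_ge0 // exprn_ge0 // ltW.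
have mu0 v : 0 <= mu v.
  by rewrite divr_ge0 ?mulr_ge0 ?sqr_ge0 ?exprn_ge0 // ltW.
have nrm_mu y v : nrm y v * mu v = normc (y v) ^+ 2 * beta v.
  rewrite /nrm /mu Normc.normcM Normc.normcV ncL.
  have Lv := lt0r_neq0 (L0 v).
  have sv : s ^+ (depth T v).*2 != 0 by rewrite expf_neq0 ?lt0r_neq0.
  by move: (s ^+ _) (L v) sv Lv => a b ? ?; field; apply/andP.
have -> : l2sum beta (Gamma T lambda phihat f) =
    (\esum_(v in [set: V]) (nrm (Gamma T lambda phihat f) v * mu v)%:E)%E.
  by apply: eq_esum => v _; rewrite nrm_mu.
apply: le_trans (_ : _ <= \esum_(v in [set: V]) ((C ^+ 2 * nrm f v) * mu v)%:E)%E _.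
  apply: (tree_majorization (T := T)) => //.
  - by move=> v; rewrite mulr_ge0 ?sqr_ge0.
  - move=> u; pose c := L u ^+ 2 / s ^+ (depth T u).+1.*2.
    have c0 : 0 <= c by rewrite divr_ge0 ?sqr_ge0 // exprn_ge0 // ltW.
    rewrite (eq_esum (b := fun v => (c%:E * (lambda v ^+ 2 * beta v)%:E)%E)).
      apply: le_trans (esumZl_le _ c0 _) _ => [v|].
        by rewrite lee_fin mulr_ge0 ?sqr_ge0 // ltW.
      apply: le_trans (lee_wpmul2l _ (chi u)) _; first by rewrite lee_fin.
      rewrite -EFinM lee_fin le_eqVlt; apply/orP; left; apply/eqP.
      rewrite /c /mu doubleS !exprS.
      have sv : s ^+ (depth T u).*2 != 0 by rewrite expf_neq0 ?lt0r_neq0.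
      have := lt0r_neq0 s0.
      by move: (s ^+ _.*2) sv => a ? ?; field; apply/andP.
    move=> v /childrenP[vr vu]; rewrite -EFinM; congr _%:E.
    rewrite /mu /c (lambda_path_rootS lambda vr) depth_par // vu exprMn.
    by ring.
  - move=> v; set d := depth T v.
    (* The path is read from the root down: [x i] sits at the ancestor of depth [i]. The sums in
       [tree_majorization] run upwards from [v], hence the reversal of indices. *)
    pose x i := f (iter (d - i) par v) / (L (iter (d - i) par v))%:C.
    have dE (i : 'I_d.+1) : depth T (iter (d - i) par v) = i.
      by rewrite depth_iter ?leq_subr // subKn // -ltnS.
    have := @conv_circle_le R phihat s C x d.+1 s0 cv leC.
    rewrite -[X in _ -> _ <= X]mulr_sumr !(reindex_inj rev_ord_inj (P := xpredT)
      (F := fun k : 'I_d.+1 => nrm _ (iter k par v))) /=.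
    have nrmE y (i : 'I_d.+1) : nrm y (iter (d.+1 - i.+1) par v) =
        normc (y (iter (d - i) par v) / (L (iter (d - i) par v))%:C) ^+ 2 * s ^+ i.*2.
      by rewrite subSS /nrm dE.
    under [X in _ -> X <= _]eq_bigr => i _ do rewrite nrmE.
    under [X in _ -> _ <= _ * X]eq_bigr => i _ do rewrite nrmE.
    have GE (i : 'I_d.+1) : \sum_(k < i.+1) phihat k * x (i - k)%N =
        Gamma T lambda phihat f (iter (d - i) par v) / (L (iter (d - i) par v))%:C.
      rewrite Gamma_path dE; apply: eq_bigr => k _; rewrite /x -iterD.
      have -> : (d - (i - k) = k + (d - i))%N; last by [].
      by have := ltn_ord i; have := ltn_ord k; lia.
    by under [X in X <= _ -> _]eq_bigr => i _ do rewrite GE.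
rewrite (eq_esum (b := fun v => ((C ^+ 2)%:E * (normc (f v) ^+ 2 * beta v)%:E)%E)).
  apply: esumZl_le => [|v]; first exact: sqr_ge0.
  by rewrite lee_fin mulr_ge0 ?sqr_ge0 // ltW.
by move=> v _; rewrite -mulrA nrm_mu EFinM.
Qed.
End Bounds.

Theorem proposition7 (R : realType) (V : choiceType) (T : rooted_directed_tree V)
    (beta lambda : V -> R) (phihat : nat -> R[i])
    (Vcountable : ([set: V] #= [set: nat])%card)
    (Tleafless : leafless T)
    (beta_gt0 : forall v, 0 < beta v)
    (lambda_gt0 : forall v, v != troot T -> 0 < lambda v)
    (Sbounded : bounded_on_l2 beta (wshift T beta lambda))
    (phi_cvg : forall z : R[i],
       disc (opnorm beta (wshift T beta lambda)) z ->
       cvgn (power_series phihat z))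
    (phi_bounded : exists K : R, forall z : R[i],
       disc (opnorm beta (wshift T beta lambda)) z ->
       Normc.normc (power_sum phihat z) <= K) :
  multipliers T beta lambda phihat /\
  (opnorm beta (mult_op T beta lambda phihat) <=
   sup_norm (disc (opnorm beta (wshift T beta lambda))) (power_sum phihat))%E.
Proof.
case: Sbounded => Adom A_lty; set s := fine (opnorm beta (wshift T beta lambda)).
have As : opnorm beta (wshift T beta lambda) = s%:E.
  by rewrite fineK // ge0_fin_numE // opnorm_ge0 // => f; rewrite Adom.
rewrite As in phi_cvg phi_bounded *.
have s0 := opnorm_wshift_gt0 beta_gt0 lambda_gt0 Tleafless Adom As.
set N := sup_norm _ _.
have phi_le z : disc s%:E z -> ((Normc.normc (power_sum phihat z))%:E <= N)%E.
  by move=> zs; apply: ereal_sup_ubound; exists z.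
(* Since [s > 0] the disc contains 0, so the supremum is over a nonempty set. *)
have N0 : (0 <= N)%E.
  apply: le_trans (phi_le 0 _); first by rewrite lee_fin normc_ge0.
  by rewrite /disc /mkset Normc.normc0 lte_fin.
have [K phiK] := phi_bounded.
(* The bound [K] makes the supremum finite, so [fine N] can serve as the sharp constant [C]. *)
have NE : N = (fine N)%:E.
  rewrite fineK // ge0_fin_numE //; apply: le_lt_trans (ltry K).
  by apply: ge_ereal_sup => _ [z zs <-]; rewrite lee_fin phiK.
have C0 : 0 <= fine N by rewrite fine_ge0.
have Gamma_le f : (l2sum beta (Gamma T lambda phihat f) <=
    (fine N ^+ 2)%:E * l2sum beta f)%E.
  apply: (@l2sum_Gamma_le _ _ _ _ _ beta_gt0 lambda_gt0 _ s) => // [u|z zs].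
  - by have [] := opnorm_wshift_children beta_gt0 lambda_gt0 u Adom As.
  - by rewrite -lee_fin -NE; exact: phi_le.
have Gamma_l2 f : l2 beta f -> l2 beta (Gamma T lambda phihat f).
  move=> fl2; apply: le_lt_trans (Gamma_le f) _.
  by rewrite -l2normE // -EFinM ltry.
split; first by apply/seteqP; split=> [f []|f fl2] //; split=> //; exact: Gamma_l2.
rewrite NE; apply: ge_ereal_sup => _ [f [[fl2 Gl2] f1] <-].
rewrite lee_fin /= -(@ler_pXn2r _ 2) ?nnegrE ?sqrtr_ge0 // -lee_fin l2normE //.
apply: le_trans (Gamma_le f) _; rewrite -l2normE // -EFinM lee_fin.
by rewrite ler_piMr ?sqr_ge0 // exprn_ile1 // sqrtr_ge0.
Qed.
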